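(* Let $G$ be a finite abelian group of order $n$, let $\xi\in\mathbb{C}$ be a primitive $n$-th root of unity, let $C=\operatorname{Spec}(R(G)\otimes_{\mathbb{Z}}\mathbb{Z}[\xi])$, and let $P\in C$ be such that $p\in P\cap\mathbb{Z}$ for some prime number $p$. Then $$\dim_{k_P}T_P(C/\mathbb{Z}[\xi])=\log_p|G/G^p|,$$ where $k_P$ is the residue field of $P$ and $G^p=\{g^p\mid g\in G\}$.
   Context: The representation ring $R(G)$ is the commutative ring of $\mathbb{Z}$-linear combinations of the irreducible complex characters of $G$, with pointwise product of characters. For a scheme $X$ over $Y=\operatorname{Spec}(A)$ and a point $P\in X$ with residue field $k_P$, the Zariski tangent space is $T_P(X/A):=\operatorname{Hom}_{k_P}(\Omega_{X/Y}\otimes_{\mathcal{O}_X}k_P,k_P)$, where $\Omega_{X/Y}$ is the sheaf of relative differentials. *)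

(* Defs.v *)
From HB Require Import structures.
From mathcomp Require Import all_boot all_order all_algebra all_fingroup.
From mathcomp Require Import all_solvable all_field all_character.
From mathcomp Require Import generic_quotient ring_quotient fraction.
From mathcomp Require Import boolp functions.
From mathcomp.multinomials Require Import freeg.

Set Implicit Arguments.
Unset Strict Implicit.
Unset Printing Implicit Defensive.

Import GRing.Theory.
Local Open Scope ring_scope.
Local Open Scope quotient_scope.

(* Classical logic (boolp) makes arbitrary submodules and ideals into the     *)
(* boolean predicates required by the quotient constructions below.           *)

Section LmodQuotient.
Variables (R : pzRingType) (V : lmodType R) (S : V -> Prop).

(* The submodule generated by S, as the intersection of those containing S. *)
Definition lspan : {pred V} := fun v =>
  `[< forall W : {pred V}, submod_closed W ->
        (forall s, S s -> s \in W) -> v \in W >].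

Lemma lspan_submod : submod_closed lspan.
Proof.
split; first by apply/asboolP => W [].
move=> a u v /asboolP Su /asboolP Sv; apply/asboolP => W WP SW.
by case: (WP) => _; apply; [apply: Su | apply: Sv].
Qed.

Lemma mem_lspan s : S s -> s \in lspan.
Proof. by move=> Ss; apply/asboolP => W _; apply. Qed.

HB.instance Definition _ :=
  GRing.isZmodClosed.Build V lspan (GRing.submod_closedB lspan_submod).

Definition lquot : Type := {ideal_quot lspan}.
HB.instance Definition _ := Quotient.on lquot.
HB.instance Definition _ := GRing.Zmodule.on lquot.

Definition lproj (v : V) : lquot := \pi_{ideal_quot lspan} v.
Definition lscale (a : R) (x : lquot) : lquot := lproj (a *: repr x).

Lemma lprojK x : lproj (repr x) = x. Proof. exact: reprK. Qed.

Lemma lproj_eq u v : lproj u = lproj v <-> u - v \in lspan.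
Proof.
rewrite Quotient.idealrBE; split=> [eq_uv | /eqP //].
by apply/eqP; exact: eq_uv.
Qed.

Lemma lprojD u v : lproj (u + v) = lproj u + lproj v.
Proof. exact: (raddfD \pi_{ideal_quot lspan}). Qed.

Lemma lscale_lproj a v : lscale a (lproj v) = lproj (a *: v).
Proof.
apply/lproj_eq; rewrite -scalerBr.
case: lspan_submod => S0 Slin; rewrite -[_ *: _]addr0; apply: Slin => //.
by apply/lproj_eq; rewrite lprojK.
Qed.

Lemma lscaleA a b x : lscale a (lscale b x) = lscale (a * b) x.
Proof. by rewrite -[x]lprojK !lscale_lproj scalerA. Qed.
Lemma lscale1 : left_id 1 lscale.
Proof. by move=> x; rewrite -[x]lprojK lscale_lproj scale1r. Qed.
Lemma lscaleDr : right_distributive lscale +%R.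
Proof.
move=> a x y; rewrite -[x]lprojK -[y]lprojK -lprojD !lscale_lproj.
by rewrite scalerDr lprojD.
Qed.
Lemma lscaleDl x : {morph lscale^~ x : a b / a + b}.
Proof. by move=> a b; rewrite -[x]lprojK !lscale_lproj scalerDl lprojD. Qed.

HB.instance Definition _ :=
  GRing.Zmodule_isLmodule.Build R lquot lscaleA lscale1 lscaleDr lscaleDl.

Lemma lproj_linear : linear lproj.
Proof. by move=> a u v; rewrite lprojD -lscale_lproj. Qed.
HB.instance Definition _ :=
  GRing.isLinear.Build R V lquot _ lproj lproj_linear.

End LmodQuotient.

Section FreegLinear.
Variables (R : nzRingType) (K : choiceType) (Z : lmodType R) (f : K -> Z).

Lemma fglift_linear : linear (fglift f : {freeg K / R} -> Z).
Proof.
have fgB : zmod_morphism (fglift f : {freeg K / R} -> Z).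
  exact: lift_is_additive.
pose g := HB.pack_for {additive {freeg K / R} -> Z}
  (fglift f : {freeg K / R} -> Z)
  (GRing.isZmodMorphism.Build _ _ _ fgB).
move=> a u v; rewrite -[LHS]/(g (a *: u + v)) raddfD; congr (_ + _).
rewrite -{1}(freeg_sumE u) scaler_sumr raddf_sum.
rewrite -[in RHS](freeg_sumE u) -[fglift _ _]/(g _) raddf_sum scaler_sumr.
apply: eq_bigr => x _ /=; rewrite liftU scalerA.
suff ->: a *: << coeff x u *g x >> = << a * coeff x u *g x >> :> {freeg K / R}.
  by rewrite liftU.
by apply/eqP/freeg_eqP => y; rewrite coeffZ !coeffU mulrA.
Qed.

End FreegLinear.

Section Tensor.
Variables (R : comNzRingType) (M N : lmodType R).
Local Notation F := {freeg (M * N)%type / R}.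
Implicit Types (m : M) (n : N) (a : R).

Definition gen m n : F := << (m, n) >>.

Inductive tensor_rel : F -> Prop :=
| tensor_relDl m m' n : tensor_rel (gen (m + m') n - gen m n - gen m' n)
| tensor_relDr m n n' : tensor_rel (gen m (n + n') - gen m n - gen m n')
| tensor_relZl a m n : tensor_rel (gen (a *: m) n - a *: gen m n)
| tensor_relZr a m n : tensor_rel (gen m (a *: n) - a *: gen m n).

(* M (x)_R N: the free R-module on M * N modulo bilinearity. *)
Definition tensor : Type := lquot tensor_rel.
HB.instance Definition _ := GRing.Lmodule.on tensor.

Definition pure m n : tensor := lproj tensor_rel (gen m n).

Lemma pureDl m m' n : pure (m + m') n = pure m n + pure m' n.
Proof.
rewrite /pure -lprojD; apply/lproj_eq/mem_lspan.
by rewrite opprD addrA; apply: tensor_relDl.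
Qed.
Lemma pureDr m n n' : pure m (n + n') = pure m n + pure m n'.
Proof.
rewrite /pure -lprojD; apply/lproj_eq/mem_lspan.
by rewrite opprD addrA; apply: tensor_relDr.
Qed.
Lemma pureZl a m n : pure (a *: m) n = a *: pure m n.
Proof.
by rewrite /pure -linearZ; apply/lproj_eq/mem_lspan; apply: tensor_relZl.
Qed.
Lemma pureZr a m n : pure m (a *: n) = a *: pure m n.
Proof.
by rewrite /pure -linearZ; apply/lproj_eq/mem_lspan; apply: tensor_relZr.
Qed.

Lemma tensor_ind (P : tensor -> Prop) :
  P 0 -> (forall a m n x, P x -> P (a *: pure m n + x)) -> forall x, P x.
Proof.
move=> P0 PS x; rewrite -[x]lprojK -[repr x]freeg_sumE.
elim: (dom (repr x : F)) => [|[m n] s IH]; first by rewrite big_nil linear0.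
rewrite big_cons; set c := coeff _ _.
suff ->: << c *g (m, n) >> = c *: gen m n :> F by rewrite linearP; apply: PS.
by apply/eqP/freeg_eqP => y; rewrite coeffZ !coeffU mul1r.
Qed.

(* The linear map induced by f; meaningful when f is bilinear. *)
Section Lift.
Variables (Z : lmodType R) (f : M -> N -> Z).

Definition tlift (x : tensor) : Z :=
  fglift (fun mn : M * N => f mn.1 mn.2) (repr x : F).

Hypotheses (flinl : forall n, linear (f^~ n)) (flinr : forall m, linear (f m)).

Lemma tlift_lproj (u : F) :
  tlift (lproj tensor_rel u) = fglift (fun mn : M * N => f mn.1 mn.2) u.
Proof.
have linf := fglift_linear (fun mn : M * N => f mn.1 mn.2).
have gE m n : fglift (fun mn : M * N => f mn.1 mn.2) (gen m n) = f m n.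
  by rewrite liftU scale1r.
rewrite /tlift; move: (fglift _) linf gE => g linf gE.
have gD v w : g (v + w) = g v + g w by rewrite -[v]scale1r linf !scale1r.
have g0 : g 0 = 0 by apply: (addrI (g 0)); rewrite -gD !addr0.
have gZ a v : g (a *: v) = a *: g v by rewrite -[a *: v]addr0 linf g0 addr0.
have gB v w : g (v - w) = g v - g w by rewrite gD -[- w]scaleN1r gZ scaleN1r.
apply/eqP; rewrite -subr_eq0 -gB; apply/eqP.
have: repr (lproj tensor_rel u) - u \in lspan tensor_rel.
  by apply/lproj_eq; rewrite lprojK.
move/asboolP/(_ [pred v | g v == 0]) => span_g; apply/eqP; apply: span_g.
  split=> [|a v w]; rewrite !inE ?g0 // linf => /eqP-> /eqP->.
  by rewrite scaler0 addr0.
have fDl n m m' : f (m + m') n = f m n + f m' n.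
  by rewrite -[m]scale1r flinl !scale1r.
have fDr m n n' : f m (n + n') = f m n + f m n'.
  by rewrite -[n]scale1r flinr !scale1r.
have f0l n : f 0 n = 0 by apply: (addrI (f 0 n)); rewrite -fDl !addr0.
have f0r m : f m 0 = 0 by apply: (addrI (f m 0)); rewrite -fDr !addr0.
have fZl a n m : f (a *: m) n = a *: f m n.
  by rewrite -[a *: m]addr0 flinl f0l addr0.
have fZr a n m : f m (a *: n) = a *: f m n.
  by rewrite -[a *: n]addr0 flinr f0r addr0.
move=> _ [m m' n|m n n'|a m n|a m n]; rewrite inE !gB ?gZ !gE.
- by rewrite fDl -addrA -opprD subrr.
- by rewrite fDr -addrA -opprD subrr.
- by rewrite fZl subrr.
- by rewrite fZr subrr.
Qed.

Lemma tlift_pure m n : tlift (pure m n) = f m n.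
Proof. by rewrite tlift_lproj liftU scale1r. Qed.

Lemma tlift_linear : linear tlift.
Proof.
move=> a x y; rewrite -[x]lprojK -[y]lprojK -linearP !tlift_lproj.
exact: fglift_linear.
Qed.

End Lift.
End Tensor.

Arguments pure {R M N} m n.

Lemma int_linear (U V : lmodType int) (f : U -> V) :
  (forall u v, f (u + v) = f u + f v) -> linear f.
Proof.
move=> fD a u v; rewrite fD; congr (_ + _).
have f0 : f 0 = 0 by apply: (addrI (f 0)); rewrite -fD !addr0.
have fB : zmod_morphism f.
  have fN w : f (- w) = - f w by apply: (addrI (f w)); rewrite -fD !subrr.
  by move=> w w'; rewrite fD fN.
pose g := HB.pack_for {additive U -> V} f (GRing.isZmodMorphism.Build _ _ _ fB).
by rewrite -[a]intz !scaler_int -[f]/(g : U -> V) raddfMz.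
Qed.

Section RingTensor.
Variables A B : comNzRingType.

(* A (x)_Z B; zmodule A is A seen as a module over int. The product, defined *)
(* by bilinear extension, satisfies rtmul_pure below.                        *)
Definition rtensor : Type := tensor (zmodule A) (zmodule B).
HB.instance Definition _ := GRing.Zmodule.on rtensor.

Definition rpure (a : A) (b : B) : rtensor :=
  pure (a : zmodule A) (b : zmodule B).

Definition rtmul1 (a : A) (b : B) : rtensor -> rtensor :=
  tlift (fun (a' : zmodule A) (b' : zmodule B) => rpure (a * a') (b * b')).

Definition rtmul (x y : rtensor) : rtensor :=
  tlift (fun (a : zmodule A) (b : zmodule B) => rtmul1 a b y) x.

Let rpureDl a a' b : rpure (a + a') b = rpure a b + rpure a' b.
Proof. exact: pureDl. Qed.
Let rpureDr a b b' : rpure a (b + b') = rpure a b + rpure a b'.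
Proof. exact: pureDr. Qed.

Let rtensor_ind (Q : rtensor -> Prop) :
  (forall x y, Q x -> Q y -> Q (x + y)) -> (forall x, Q x -> Q (- x)) ->
  (forall a b, Q (rpure a b)) -> forall x, Q x.
Proof.
move=> QD QN Qp; have Q0 : Q 0.
  rewrite -[0](subrr (rpure 0 0)); apply: (QD); first exact: Qp.
  by apply: (QN); apply: Qp.
apply: tensor_ind => // c a b x Qx; apply: (QD); last by [].
have Qn n : Q (rpure a b *+ n).
  by elim: n => // n IH; rewrite mulrS; apply: (QD).
have -> : c *: (rpure a b : tensor (zmodule A) (zmodule B)) = rpure a b *~ c.
  by rewrite -[c in LHS]intz scaler_int.
case: c => n; first exact: Qn.
by rewrite NegzE mulrNz; apply: (QN); apply: Qn.
Qed.

Let rtmul1_pure a b a' b' :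
  rtmul1 a b (rpure a' b') = rpure (a * a') (b * b').
Proof.
apply: (tlift_pure
  (f := fun (a' : zmodule A) (b' : zmodule B) => rpure (a * a') (b * b'))).
  by move=> n; apply: int_linear => u v; rewrite mulrDr rpureDl.
by move=> n; apply: int_linear => u v; rewrite mulrDr rpureDr.
Qed.

Let rtmul1D a b x y : rtmul1 a b (x + y) = rtmul1 a b x + rtmul1 a b y.
Proof.
rewrite -[x in LHS]scale1r.
rewrite /rtmul1 tlift_linear ?scale1r //.
  by move=> n; apply: int_linear => u v; rewrite mulrDr rpureDl.
by move=> n; apply: int_linear => u v; rewrite mulrDr rpureDr.
Qed.

Let rtmul1N a b x : rtmul1 a b (- x) = - rtmul1 a b x.
Proof.
apply: (addrI (rtmul1 a b x)); rewrite -rtmul1D !subrr.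
by apply: (addrI (rtmul1 a b 0)); rewrite -rtmul1D !addr0.
Qed.

Let rtmul1Dl a a' b x : rtmul1 (a + a') b x = rtmul1 a b x + rtmul1 a' b x.
Proof.
elim/rtensor_ind: x => [x y IHx IHy|x IHx|u v].
- by rewrite !rtmul1D IHx IHy addrACA.
- by rewrite !rtmul1N IHx opprD.
- by rewrite !rtmul1_pure mulrDl rpureDl.
Qed.

Let rtmul1Dr a b b' x : rtmul1 a (b + b') x = rtmul1 a b x + rtmul1 a b' x.
Proof.
elim/rtensor_ind: x => [x y IHx IHy|x IHx|u v].
- by rewrite !rtmul1D IHx IHy addrACA.
- by rewrite !rtmul1N IHx opprD.
- by rewrite !rtmul1_pure mulrDl rpureDr.
Qed.

Let rtmul_purel a b x : rtmul (rpure a b) x = rtmul1 a b x.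
Proof.
apply: (tlift_pure (f := fun (a : zmodule A) (b : zmodule B) => rtmul1 a b x)).
  by move=> n; apply: int_linear => u v; rewrite rtmul1Dl.
by move=> n; apply: int_linear => u v; rewrite rtmul1Dr.
Qed.

Lemma rtmul_pure a b a' b' :
  rtmul (rpure a b) (rpure a' b') = rpure (a * a') (b * b').
Proof. by rewrite rtmul_purel rtmul1_pure. Qed.

Let rtmulDl : left_distributive rtmul +%R.
Proof.
move=> x y z; rewrite -[x in LHS]scale1r /rtmul tlift_linear ?scale1r //.
  by move=> n; apply: int_linear => u v; rewrite rtmul1Dl.
by move=> n; apply: int_linear => u v; rewrite rtmul1Dr.
Qed.

Let rtmulNl x y : rtmul (- x) y = - rtmul x y.
Proof.
apply: (addrI (rtmul x y)); rewrite -rtmulDl !subrr.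
by apply: (addrI (rtmul 0 y)); rewrite -rtmulDl !addr0.
Qed.

Let rtmulC : commutative rtmul.
Proof.
move=> x; elim/rtensor_ind: x => [x y IHx IHy|x IHx|a b] z.
- rewrite rtmulDl IHx IHy; elim/rtensor_ind: z => [u v IHu IHv|u IHu|u v].
  + by rewrite !rtmulDl -IHu -IHv addrACA.
  + by rewrite !rtmulNl -IHu opprD.
  + by rewrite !rtmul_purel rtmul1D.
- rewrite rtmulNl IHx; elim/rtensor_ind: z => [u v IHu IHv|u IHu|u v].
  + by rewrite !rtmulDl -IHu -IHv opprD.
  + by rewrite !rtmulNl -IHu.
  + by rewrite !rtmul_purel rtmul1N.
- elim/rtensor_ind: z => [u v IHu IHv|u IHu|u v].
  + by rewrite rtmulDl -IHu -IHv !rtmul_purel rtmul1D.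
  + by rewrite rtmulNl -IHu !rtmul_purel rtmul1N.
  + by rewrite !rtmul_pure mulrC [v * b]mulrC.
Qed.

Let rtmulDr x y z : rtmul x (y + z) = rtmul x y + rtmul x z.
Proof. by rewrite ![rtmul x _]rtmulC rtmulDl. Qed.

Let rtmulNr x y : rtmul x (- y) = - rtmul x y.
Proof. by rewrite ![rtmul x _]rtmulC rtmulNl. Qed.

Let rtmulA : associative rtmul.
Proof.
move=> x y z; elim/rtensor_ind: x => [x1 x2 IH1 IH2|x IHx|a b].
- by rewrite !rtmulDl IH1 IH2.
- by rewrite !rtmulNl IHx.
elim/rtensor_ind: y => [y1 y2 IH1 IH2|y IHy|a' b'].
- by rewrite !(rtmulDl, rtmulDr) IH1 IH2.
- by rewrite !(rtmulNl, rtmulNr) IHy.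
elim/rtensor_ind: z => [z1 z2 IH1 IH2|z IHz|a'' b''].
- by rewrite !rtmulDr IH1 IH2.
- by rewrite !rtmulNr IHz.
by rewrite !rtmul_pure !mulrA.
Qed.

Let rtmul1r : left_id (rpure 1 1) rtmul.
Proof.
elim/rtensor_ind => [x y IHx IHy|x IHx|a b].
- by rewrite rtmulDr IHx IHy.
- by rewrite rtmulNr IHx.
- by rewrite rtmul_pure !mul1r.
Qed.

HB.instance Definition _ :=
  GRing.Zmodule_isComPzRing.Build rtensor rtmulA rtmulC rtmul1r rtmulDl.

Definition rtensorr (b : B) : rtensor := rpure 1 b.

Let rtensorr_zmod : zmod_morphism rtensorr.
Proof.
move=> b b'; rewrite /rtensorr; apply: (addIr (rpure 1 b')).
by rewrite -rpureDr !subrK.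
Qed.
Let rtensorr_monoid : monoid_morphism rtensorr.
Proof.
split=> // b b'; rewrite -[RHS]/(rtmul (rpure 1 b) (rpure 1 b')).
by rewrite rtmul_pure mulr1.
Qed.
HB.instance Definition _ :=
  GRing.isZmodMorphism.Build B rtensor rtensorr rtensorr_zmod.
HB.instance Definition _ :=
  GRing.isMonoidMorphism.Build B rtensor rtensorr rtensorr_monoid.

End RingTensor.

Section Kahler.
Variables (A B : comNzRingType) (phi : {rmorphism A -> B}).

Definition dgen (b : B) : {freeg B / B} := << b >>.

Inductive kahler_rel : {freeg B / B} -> Prop :=
| kahler_relD b b' : kahler_rel (dgen (b + b') - dgen b - dgen b')
| kahler_relM b b' : kahler_rel (dgen (b * b') - b *: dgen b' - b' *: dgen b)
| kahler_relC a : kahler_rel (dgen (phi a)).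

(* Omega_{B/A}: the B-module generated by the symbols db for b in B, with     *)
(* d additive, satisfying the Leibniz rule and vanishing on the image of A.   *)
Definition kahler : Type := lquot kahler_rel.
HB.instance Definition _ := GRing.Lmodule.on kahler.

Definition kahler_d (b : B) : kahler := lproj kahler_rel (dgen b).

End Kahler.

Section BaseChange.
Variables (B k : comNzRingType) (phi : {rmorphism B -> k}).

(* k seen as a B-module through phi. *)
Definition restr (psi : {rmorphism B -> k}) : Type := k.
HB.instance Definition _ := GRing.Zmodule.on (restr phi).

Definition restr_scale (b : B) (x : restr phi) : restr phi := phi b * (x : k).

Let restr_scaleA a b x :
  restr_scale a (restr_scale b x) = restr_scale (a * b) x.
Proof. by rewrite /restr_scale mulrA -rmorphM. Qed.
Let restr_scale1 : left_id 1 restr_scale.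
Proof. by move=> x; rewrite /restr_scale rmorph1 mul1r. Qed.
Let restr_scaleDr : right_distributive restr_scale +%R.
Proof. by move=> a x y; rewrite /restr_scale mulrDr. Qed.
Let restr_scaleDl x : {morph restr_scale^~ x : a b / a + b}.
Proof. by move=> a b; rewrite /restr_scale rmorphD mulrDl. Qed.
HB.instance Definition _ := GRing.Zmodule_isLmodule.Build B (restr phi)
  restr_scaleA restr_scale1 restr_scaleDr restr_scaleDl.

Variable M : lmodType B.

(* M (x)_B k, as a module over k acting on the second factor. *)
Definition base_change : Type := tensor M (restr phi).
HB.instance Definition _ := GRing.Zmodule.on base_change.

Definition bc_pure (m : M) (x : k) : base_change := pure m (x : restr phi).

Definition bc_scale (c : k) : base_change -> base_change :=
  tlift (fun (m : M) (x : restr phi) => pure m (c * (x : k) : restr phi)).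

Let bc_flinl c (x : restr phi) :
  linear (fun m : M => pure m (c * (x : k) : restr phi)).
Proof. by move=> b m m'; rewrite pureDl pureZl. Qed.

Let bc_flinr c (m : M) :
  linear (fun x : restr phi => pure m (c * (x : k) : restr phi)).
Proof.
move=> b x y; rewrite -pureZr -pureDr; congr pure.
rewrite -[RHS]/(phi b * (c * x) + c * y) -[LHS]/(c * (phi b * x + y)).
by rewrite mulrDr mulrCA.
Qed.

Lemma bc_scale_pure c m x : bc_scale c (bc_pure m x) = bc_pure m (c * x).
Proof. exact: (tlift_pure (@bc_flinl c) (@bc_flinr c)). Qed.

Let bc_scaleP c b (x y : tensor M (restr phi)) :
  bc_scale c (b *: x + y) =
    b *: (bc_scale c x : tensor M (restr phi)) + bc_scale c y.
Proof. exact: (tlift_linear (@bc_flinl c) (@bc_flinr c)). Qed.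

Let bc_scaleDr : right_distributive bc_scale +%R.
Proof.
move=> c x y; rewrite -[x in LHS](scale1r (x : tensor M (restr phi))).
by rewrite bc_scaleP scale1r.
Qed.

Let bc_scale0 c : bc_scale c 0 = 0.
Proof. by apply: (addrI (bc_scale c 0)); rewrite -bc_scaleDr !addr0. Qed.

Let bc_scaleA a b x : bc_scale a (bc_scale b x) = bc_scale (a * b) x.
Proof.
elim/tensor_ind: x => [|c m x y IH]; first by rewrite !bc_scale0.
by rewrite !bc_scaleP IH !bc_scale_pure mulrA.
Qed.
Let bc_scale1 : left_id 1 bc_scale.
Proof.
elim/tensor_ind => [|c m x y IH]; first by rewrite !bc_scale0.
by rewrite !bc_scaleP IH !bc_scale_pure mul1r.
Qed.
Let bc_scaleDl x : {morph bc_scale^~ x : a b / a + b}.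
Proof.
move=> a b; elim/tensor_ind: x => [|c m x y IH].
  by rewrite !bc_scale0 addr0.
rewrite !bc_scaleP IH !bc_scale_pure.
by rewrite {1}/bc_pure mulrDl pureDr scalerDr addrACA.
Qed.
HB.instance Definition _ := GRing.Zmodule_isLmodule.Build k base_change
  bc_scaleA bc_scale1 bc_scaleDr bc_scaleDl.

End BaseChange.

Section Dual.
Variables (k : comNzRingType) (V : lmodType k).

Definition linear_form : {pred V -> k^o} := fun f => `[< linear f >].

Lemma linear_form_submod : submod_closed linear_form.
Proof.
split; first by apply/asboolP => a u v; rewrite /= scaler0 addr0.
move=> c f g /asboolP lf /asboolP lg; apply/asboolP => a u v /=.
rewrite -[LHS]/(c *: f (a *: u + v) + g (a *: u + v)).
rewrite -[RHS]/(a *: (c *: f u + g u) + (c *: f v + g v)).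
by rewrite lf lg !scalerDr !scalerA [c * a]mulrC addrACA.
Qed.
HB.instance Definition _ :=
  GRing.isSubmodClosed.Build k (V -> k^o) linear_form linear_form_submod.

(* Hom_k(V, k), with pointwise operations. *)
Definition dual : Type := {f : V -> k^o | f \in linear_form}.
HB.instance Definition _ := [isSub of dual for @sval _ _].
HB.instance Definition _ := [Choice of dual by <:].
HB.instance Definition _ := [SubChoice_isSubLmodule of dual by <:].

End Dual.

Definition has_dim (k : fieldType) (V : lmodType k) (d : nat) : Prop :=
  exists f : {linear 'rV[k]_d -> V}, bijective f.

Section ResidueField.
Variables (B : comNzRingType) (P : prime_idealr B).

Definition prime_quot : Type := {ideal_quot P}.
HB.instance Definition _ := GRing.ComNzRing.on prime_quot.

Definition pq_unit : {pred prime_quot} := fun x => `[< exists y, y * x = 1 >].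
Definition pq_inv (x : prime_quot) : prime_quot :=
  if pselect (exists y, y * x = 1) is left xU then sval (cid xU) else x.

Let pq_mulVr : {in pq_unit, left_inverse 1 pq_inv *%R}.
Proof.
by move=> x /asboolP xU; rewrite /pq_inv; case: pselect => // ?; case: cid.
Qed.
Let pq_unitP x y : y * x = 1 -> x \in pq_unit.
Proof. by move=> yx; apply/asboolP; exists y. Qed.
Let pq_inv_out : {in [predC pq_unit], pq_inv =1 id}.
Proof. by move=> x /asboolP xU; rewrite /pq_inv; case: pselect. Qed.
HB.instance Definition _ := GRing.ComNzRing_hasMulInverse.Build prime_quot
  pq_mulVr pq_unitP pq_inv_out.
HB.instance Definition _ := GRing.ComUnitRing_isIntegral.Build prime_quot
  (@Quotient.rquot_IdomainAxiom B P).

(* The residue field at P of Spec B, as the fraction field of B / P. *)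
Definition residue_field : Type := {fraction prime_quot}.
HB.instance Definition _ := GRing.Field.on residue_field.

Definition residue_map (b : B) : residue_field :=
  FracField.tofrac (\pi_{ideal_quot P} b : prime_quot).

Let residue_map_zmod : zmod_morphism residue_map.
Proof. by move=> b b'; rewrite /residue_map !raddfB. Qed.
Let residue_map_monoid : monoid_morphism residue_map.
Proof. by split=> [|b b']; rewrite /residue_map ?rmorph1 ?rmorphM. Qed.
HB.instance Definition _ :=
  GRing.isZmodMorphism.Build B residue_field residue_map residue_map_zmod.
HB.instance Definition _ :=
  GRing.isMonoidMorphism.Build B residue_field residue_map residue_map_monoid.

End ResidueField.

(* The Zariski tangent space at P of Spec B over Spec A. On affine schemes,   *)
(* the sheaf of relative differentials is the one attached to kahler phi, and *)
(* its fibre at P is the base change of kahler phi to the residue field of P. *)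
Definition tangent (A B : comNzRingType) (phi : {rmorphism A -> B})
    (P : prime_idealr B) : lmodType (residue_field P) :=
  dual (base_change (residue_map P) (kahler phi)).

Section ReprRing.
Variables (gT : finGroupType) (G : {group gT}).

(* R(G): the virtual characters of G, i.e., the Z-linear combinations of its  *)
(* irreducible characters, inside the ring of class functions.                *)
Definition repr_ring : Type := {phi : 'CF(G) | phi \in 'Z[irr G]%g}.
HB.instance Definition _ := [isSub of repr_ring for @sval _ _].
HB.instance Definition _ := [Choice of repr_ring by <:].
HB.instance Definition _ := [SubChoice_isSubComNzRing of repr_ring by <:].

End ReprRing.

Section IntAdjoin.
Variable xi : algC.

Definition int_adjoin_pred : {pred algC} :=
  fun z => `[< exists q : {poly int}, z = (map_poly intr q).[xi] >].

Lemma int_adjoin_subring : subring_closed int_adjoin_pred.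
Proof.
split; first by apply/asboolP; exists 1; rewrite rmorph1 hornerC.
- move=> _ _ /asboolP[q ->] /asboolP[r ->]; apply/asboolP; exists (q - r).
  by rewrite rmorphB hornerD hornerN.
- move=> _ _ /asboolP[q ->] /asboolP[r ->]; apply/asboolP; exists (q * r).
  by rewrite rmorphM hornerM.
Qed.
HB.instance Definition _ :=
  GRing.isSubringClosed.Build algC int_adjoin_pred int_adjoin_subring.

Definition int_adjoin : Type := {z : algC | z \in int_adjoin_pred}.
HB.instance Definition _ := [isSub of int_adjoin for @sval _ _].
HB.instance Definition _ := [Choice of int_adjoin by <:].
HB.instance Definition _ := [SubChoice_isSubComNzRing of int_adjoin by <:].

End IntAdjoin.

Section ReprRingAdjoin.
Variables (gT : finGroupType) (G : {group gT}) (xi : algC).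

Definition repr_ring_adjoin : Type := rtensor (repr_ring G) (int_adjoin xi).
HB.instance Definition _ := GRing.ComPzRing.on repr_ring_adjoin.

Let repr_ring_adjoin_neq0 : (1 : repr_ring_adjoin) != 0.
Proof.
pose f (chi : zmodule (repr_ring G)) (z : zmodule (int_adjoin xi)) :
  zmodule algC := val (chi : repr_ring G) 1%g * val (z : int_adjoin xi).
have fl z : linear (f^~ z).
  by apply: int_linear => u v; rewrite /f cfunE mulrDl.
have fr chi : linear (f chi).
  by apply: int_linear => u v; rewrite /f mulrDr.
apply/eqP => /(congr1 (tlift f)).
rewrite -[1]/(rpure (1 : repr_ring G) (1 : int_adjoin xi)).
rewrite /rpure (tlift_pure fl fr).
have -> : tlift f 0 = 0.
  apply: (addrI (tlift f 0)).
  by rewrite -{1}[tlift f 0]scale1r -(tlift_linear fl fr) scale1r !addr0.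
by rewrite /f cfun1E group1 mul1r => /eqP; rewrite oner_eq0.
Qed.
HB.instance Definition _ :=
  GRing.PzSemiRing_isNonZero.Build repr_ring_adjoin repr_ring_adjoin_neq0.

Definition adjoin_map (z : int_adjoin xi) : repr_ring_adjoin := rtensorr _ z.
HB.instance Definition _ := GRing.RMorphism.copy adjoin_map
  (@rtensorr (repr_ring G) (int_adjoin xi)).

End ReprRingAdjoin.

Arguments adjoin_map {gT} G xi z.

(* G^p, as a set; it is a subgroup when G is abelian. *)
Definition group_powers (gT : finGroupType) (G : {set gT}) (p : nat) :
  {set gT} := [set (g ^+ p)%g | g in G].

(* Main.v *)
Require Import Defs.
From HB Require Import structures.
From mathcomp Require Import all_boot all_order all_algebra all_fingroup.
From mathcomp Require Import all_solvable all_field all_character.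
From mathcomp Require Import ring_quotient generic_quotient fraction.
From mathcomp Require Import boolp.
From mathcomp.multinomials Require Import freeg.

Set Implicit Arguments.
Unset Strict Implicit.
Unset Printing Implicit Defensive.

Import GRing.Theory Num.Theory.
Local Open Scope ring_scope.

(** Write B for R(G) tensored with Z[xi], k for the residue field of P and psi
    for the map from B to k. A linear form on the fibre of the module of
    differentials at P is the same as a Z[xi]-linear derivation D : B -> k,
    where k is a B-module through psi ([derivation_of_inj] and
    [derivation_of_surj]); so the tangent space is a space of derivations.

    As G is abelian, R(G) is the group ring over the integers of the group L of
    linear characters of G. The Leibniz rule on a product of two linear
    characters chi and chi' says precisely that the logarithmic derivative
    chi |-> D(chi) / psi(chi) is a homomorphism from L to the additive group
    of k, where psi(chi) is invertible because chi is. Conversely every such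
    homomorphism h comes from exactly one derivation: linear characters form
    an integral basis of R(G), so that chi |-> psi(chi) h(chi) extends
    additively to R(G) and then Z[xi]-linearly to B. The tangent space is
    therefore Hom(L, k) ([log_derivativeM], [log_derivative_eq0] and
    [log_derivative_surj]).

    Since p lies in P, the field k has characteristic p. Hence homomorphisms
    from L to k factor through L / L^p, which is a vector space over the field
    with p elements, and Hom(L, k) has the dimension d of that space
    ([additive_char_coordinates]), where p ^ d = #|L / L^p|. Finally
    #|L / L^p| is the number of characters killed by p, i.e., trivial on G^p;
    those are the characters of G / G^p, so there are #|G / G^p| of them
    ([card_dual_powers_quotient]). *)

(** * Universal properties of quotient modules and of differentials *)

(** The quotient constructions produce plain functions with a proof of
    linearity rather than bundled linear maps; these are the usual identities
    for such functions. *)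
Section LinearFacts.
Variables (R : pzRingType) (V Z : lmodType R) (g : V -> Z).
Hypothesis g_lin : linear g.

Lemma linear_fun0 : g 0 = 0.
Proof. by have := g_lin (-1) 0 0; rewrite scaler0 addr0 scaleN1r addNr. Qed.

Lemma linear_funD u v : g (u + v) = g u + g v.
Proof. by rewrite -[u]scale1r g_lin !scale1r. Qed.

Lemma linear_funZ a u : g (a *: u) = a *: g u.
Proof. by rewrite -[a *: u]addr0 g_lin linear_fun0 addr0. Qed.

Lemma linear_funB u v : g (u - v) = g u - g v.
Proof. by rewrite linear_funD -scaleN1r linear_funZ scaleN1r. Qed.

Lemma lquot_lift (S : V -> Prop) :
  (forall v, S v -> g v = 0) ->
  exists2 h : lquot S -> Z, linear h & forall v, h (lproj S v) = g v.
Proof.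
move=> gS.
have hE v : g (repr (lproj S v)) = g v.
  apply/eqP; rewrite -subr_eq0 -linear_funB.
  have /asboolP/(_ [pred v | g v == 0]) : repr (lproj S v) - v \in lspan S.
    by apply/lproj_eq; rewrite lprojK.
  apply=> [|s /gS gs0]; last by rewrite inE gs0.
  split=> [|a u w]; rewrite !inE ?linear_fun0 // g_lin => /eqP-> /eqP->.
  by rewrite scaler0 addr0.
exists (fun x => g (repr x)) => // a x y.
by rewrite -[x]lprojK -[y]lprojK -linearP !hE g_lin.
Qed.

End LinearFacts.

(** Differentials of ring elements generate the module, so linear maps on it
    can be compared on the elements d c alone. *)
Lemma kahler_ind (A B : comNzRingType) (phi : {rmorphism A -> B})
    (Q : kahler phi -> Prop) :
  Q 0 -> (forall b c x, Q x -> Q (b *: kahler_d phi c + x)) -> forall x, Q x.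
Proof.
move=> Q0 QS x; rewrite -[x]lprojK -[repr x]freeg_sumE.
elim: (dom _) => [|c s IH]; first by rewrite big_nil linear0.
rewrite big_cons; set b := coeff _ _.
suff ->: << b *g c >> = b *: dgen c by rewrite linearP; apply: QS.
by apply/eqP/freeg_eqP => y; rewrite coeffZ !coeffU mul1r.
Qed.

Section TangentDerivations.
Variables (A B k : comNzRingType).
Variables (phi : {rmorphism A -> B}) (psi : {rmorphism B -> k}).

Definition is_derivation (D : B -> k) : Prop :=
  [/\ forall b c, D (b + c) = D b + D c,
      forall b c, D (b * c) = psi b * D c + psi c * D b
    & forall a, D (phi a) = 0].

Lemma kahler_dP :
  [/\ forall b c, kahler_d phi (b + c) = kahler_d phi b + kahler_d phi c,
      forall b c,
        kahler_d phi (b * c) = b *: kahler_d phi c + c *: kahler_d phi b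
    & forall a, kahler_d phi (phi a) = 0].
Proof.
rewrite /kahler_d; split=> [b c|b c|a].
- rewrite -lprojD; apply/lproj_eq/mem_lspan; rewrite opprD addrA.
  exact: kahler_relD.
- rewrite -!linearZ -lprojD; apply/lproj_eq/mem_lspan; rewrite opprD addrA.
  exact: kahler_relM.
- rewrite -[RHS](linear0 (lproj (kahler_rel phi))); apply/lproj_eq/mem_lspan.
  rewrite subr0; exact: kahler_relC.
Qed.

Notation fibre := (base_change psi (kahler phi)).

Definition derivation_of (f : dual fibre) (b : B) : k :=
  sval f (bc_pure psi (kahler_d phi b) 1).

Lemma dual_linear (f : dual fibre) : linear (sval f).
Proof. by case: f => f /= /asboolP. Qed.

Lemma bc_pureZ b (m : kahler phi) c :
  bc_pure psi (b *: m) c = psi b *: bc_pure psi m c.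
Proof.
rewrite [RHS]bc_scale_pure /bc_pure pureZl -pureZr.
by congr pure.
Qed.

Lemma bc_pureDl (m m' : kahler phi) c :
  bc_pure psi (m + m') c = bc_pure psi m c + bc_pure psi m' c.
Proof. exact: pureDl. Qed.

Lemma derivation_ofP f : is_derivation (derivation_of f).
Proof.
have [dD dM dC] := kahler_dP; have flin := dual_linear f.
split=> [b c|b c|a]; rewrite /derivation_of.
- by rewrite dD bc_pureDl (linear_funD flin).
- by rewrite dM bc_pureDl !bc_pureZ (linear_funD flin) !(linear_funZ flin).
- rewrite dC; have -> : bc_pure psi (0 : kahler phi) 1 = 0.
    by rewrite -(scale0r 0) bc_pureZ rmorph0 scale0r.
  exact: (linear_fun0 flin).
Qed.

(** The elements db (x) 1 span the fibre over k: a scalar of B on the left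
    factor moves to the right one as an element of k, where it is a factor. *)
Lemma derivation_of_inj f g : derivation_of f =1 derivation_of g -> f = g.
Proof.
move=> fg; apply/val_inj/funext; rewrite /=.
have [flin glin] := (dual_linear f, dual_linear g).
elim/tensor_ind => [|b m c x IH].
  by rewrite [LHS](linear_fun0 flin) [RHS](linear_fun0 glin).
rewrite -pureZl [LHS](linear_funD flin) [RHS](linear_funD glin) IH.
congr (_ + _); move: (b *: m) => {b x IH}m.
have pE m' : pure m' c = c *: bc_pure psi m' 1.
  by rewrite [RHS]bc_scale_pure mulr1.
rewrite pE [LHS](linear_funZ flin) [RHS](linear_funZ glin); congr (_ *: _).
elim/kahler_ind: m => [|b b' m IH].
  have -> : bc_pure psi (0 : kahler phi) 1 = 0.
    by rewrite -(scale0r 0) bc_pureZ rmorph0 scale0r.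
  by rewrite [LHS](linear_fun0 flin) [RHS](linear_fun0 glin).
rewrite bc_pureDl bc_pureZ [LHS]flin [RHS]glin IH.
by congr (_ *: _ + _); apply: fg.
Qed.

(** The relations that define the differentials are those satisfied by a
    derivation, so D induces a B-linear map h with h (db) = D b, and
    m (x) c |-> h m * c is the required form. *)
Lemma derivation_of_surj D :
  is_derivation D -> exists f, derivation_of f =1 D.
Proof.
case=> DD DM DC; pose D' b : restr psi := D b.
have glin := fglift_linear D'; set g := fglift D' in glin.
have gE b : g (dgen b) = D' b by rewrite /g liftU scale1r.
have [_ [b c|b c|a]|h hlin hE] := lquot_lift glin (S := kahler_rel phi).
- rewrite !(linear_funB glin) !gE [D' (b + c)]DD.
  by rewrite (addrC (D b)) -[X in X - _]addrA subrr addr0 subrr.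
- rewrite !(linear_funB glin) !(linear_funZ glin) !gE [D' (b * c)]DM.
  by rewrite (addrC (psi b * _)) -[X in X - _]addrA subrr addr0 subrr.
- by rewrite gE; apply: DC.
have hdE b : h (kahler_d phi b) = D' b by rewrite hE gE.
pose F (m : kahler phi) (c : restr psi) : restr psi := (h m : k) * (c : k).
have Fl c : linear (F^~ c).
  move=> b m m'; rewrite /F hlin.
  by rewrite -[LHS]/((psi b * (h m : k) + (h m' : k)) * (c : k)) mulrDl -mulrA.
have Fr m : linear (F m).
  move=> b c c'; rewrite -[LHS]/((h m : k) * (psi b * (c : k) + (c' : k))).
  by rewrite mulrDr mulrCA.
pose f0 (x : fibre) : k^o := tlift F x.
have f0lin : linear f0.
  move=> c x y; rewrite /f0 (linear_funD (tlift_linear Fl Fr)).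
  congr (_ + _); elim/tensor_ind: x => [|b m d x IH].
    by rewrite scaler0 (linear_fun0 (tlift_linear Fl Fr)) scaler0.
  rewrite -pureZl scalerDr !(linear_funD (tlift_linear Fl Fr)) IH scalerDr.
  congr (_ + _); rewrite -[c *: _]/(bc_scale c (bc_pure psi (b *: m) d)).
  rewrite bc_scale_pure !(tlift_pure Fl Fr).
  exact: mulrCA.
have f0P : f0 \in @linear_form k fibre by apply/asboolP.
exists (exist _ f0 f0P) => b.
by rewrite /derivation_of /= /f0 (tlift_pure Fl Fr) /F hdE mulr1.
Qed.

End TangentDerivations.

(** * Additive characters of a finite abelian group in characteristic p *)

Section AdditiveCharacters.
Variables (gT : finGroupType) (L : {group gT}) (p : nat).
Hypotheses (cLL : abelian L) (p_pr : prime p).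

Lemma group_powers_group_set : group_set (group_powers L p).
Proof.
apply/group_setP; split; first by apply/imsetP; exists 1%g; rewrite ?expg1n.
move=> _ _ /imsetP[u Lu ->] /imsetP[v Lv ->]; apply/imsetP; exists (u * v)%g.
  exact: groupM.
by rewrite expgMn //; apply: (centsP cLL).
Qed.

Definition powers_group := Group group_powers_group_set.

Lemma powers_normal : (powers_group <| L)%g.
Proof.
rewrite -sub_abelian_normal //; apply/subsetP => _ /imsetP[u Lu ->].
exact: groupX.
Qed.

Lemma powers_quotient_abelem : (p.-abelem (L / powers_group))%g.
Proof.
apply/abelemP => //; split; first exact: quotient_abelian.
move=> _ /morphimP[u Nu Lu ->]; rewrite -morphX //; apply: coset_id.
by apply/imsetP; exists u.
Qed.

Section IntoField.
Variable k : fieldType.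
Hypothesis k_p : p%:R = 0 :> k.

Definition additive_char (h : gT -> k) : Prop :=
  {in L &, {morph h : u v / (u * v)%g >-> u + v}}.

Lemma additive_char_powers h :
  additive_char h -> {in powers_group, h =1 fun=> 0}.
Proof.
move=> hM _ /imsetP[u Lu ->].
have h1 : h 1%g = 0.
  by apply: (addrI (h 1%g)); rewrite -hM ?group1 // mulg1 addr0.
suff hX n : h (u ^+ n)%g = h u *+ n by rewrite hX -mulr_natr k_p mulr0.
by elim: n => // n IH; rewrite expgS hM ?groupX // IH mulrS.
Qed.

Lemma additive_char_coset h : additive_char h ->
  {in L &, forall u v,
    coset powers_group u = coset powers_group v -> h u = h v}.
Proof.
move=> hM u v Lu Lv.
have NL := subsetP (normal_norm powers_normal).
move/(rcoset_kercosetP (NL _ Lu) (NL _ Lv)) => /rcosetP[w Kw ->].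
have Lw := subsetP (normal_sub powers_normal) _ Kw; rewrite hM //.
by rewrite (additive_char_powers hM Kw) add0r.
Qed.

End IntoField.

(** The elements x_j lift a basis of L / L^p over the field with p elements.
    They are chosen independently of k, because h |-> (h (x_j))_j has to be an
    isomorphism from Hom(L, k) to k^d with d read off from L alone. *)
Lemma additive_char_coordinates :
  exists (d : nat) (x : 'I_d -> gT),
  [/\ (p ^ d)%N = #|(L / group_powers L p)%g|, forall j, x j \in L
    & forall k : fieldType, p%:R = 0 :> k ->
      (forall h : gT -> k, additive_char h -> (forall j, h (x j) = 0) ->
         {in L, h =1 fun=> 0})
      /\ (forall c : 'rV[k]_d, exists2 h, additive_char h &
           forall j, h (x j) = c 0 j)].
Proof.
have abE := powers_quotient_abelem; have nKL := normal_norm powers_normal.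
(* The coordinates on an elementary abelian p-group are only available when
   the group is not trivial. *)
have [E1|ntE] := eqVneq (L / powers_group)%g [1]%g.
  have absurd0 (j : 'I_0) : False by case: j.
  exists 0%N, (fun j => False_rect gT (absurd0 j)); split=> [|[]//|k kp].
    by rewrite [(L / _)%g]E1 cards1.
  split=> [h hM _ u Lu|c]; last first.
    by exists (fun=> 0) => [u v _ _|[]//]; rewrite addr0.
  apply: (additive_char_powers kp hM); apply: (subsetP _ _ Lu).
  by rewrite -quotient_sub1 // E1.
pose E := (L / powers_group)%G; pose d := 'dim E.
have lift_ex (v : 'rV['F_p]_d) :
    exists u, (u \in L) && (coset powers_group u == rVabelem abE ntE v).
  have /morphimP[u _ Lu ->] := mem_rVabelem abE ntE v.
  by exists u; rewrite Lu eqxx.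
pose lift v := xchoose (lift_ex v).
have liftL v : lift v \in L by case/andP: (xchooseP (lift_ex v)).
have liftE v : coset powers_group (lift v) = rVabelem abE ntE v.
  by case/andP: (xchooseP (lift_ex v)) => _ /eqP.
pose co u : 'rV['F_p]_d := abelem_rV abE ntE (coset powers_group u).
have coL u : u \in L -> coset powers_group u \in (L / powers_group)%g.
  exact: mem_quotient.
have liftK v : co (lift v) = v by rewrite /co liftE rVabelemK.
have coM : {in L &, {morph co : u v / (u * v)%g >-> u + v}}.
  move=> u v Lu Lv; rewrite /co coset_morphM ?(subsetP nKL) //.
  by rewrite abelem_rV_M ?coL.
exists d, (fun j => lift (delta_mx 0 j)); split=> // [|k kp].
  by rewrite -(card_abelem_rV abE ntE) card_mx card_Fp // mul1n.
split=> [h hM h0 u Lu|c].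
  (* As h kills L^p, it induces an additive function on coordinate vectors. *)
  pose hb v := h (lift v).
  have hbD v w : hb (v + w) = hb v + hb w.
    rewrite /hb -hM //; apply: (additive_char_coset kp hM) => //.
      by rewrite groupM ?liftL.
    by rewrite coset_morphM ?(subsetP nKL) // !liftE rVabelemD.
  have hb0 : hb 0 = 0 by apply: (addrI (hb 0)); rewrite -hbD !addr0.
  have -> : h u = hb (co u).
    apply: (additive_char_coset kp hM) => //.
    by rewrite liftE abelem_rV_K ?coL.
  rewrite [co u]row_sum_delta (big_morph hb hbD hb0) big1 // => j _.
  rewrite -[co u 0 j]natr_Zp scaler_nat.
  elim: (nat_of_ord _) => [|m IH]; first by rewrite mulr0n.
  by rewrite mulrS hbD IH addr0; apply: h0.
(* The residue of a modulo p has a well defined image in k. *)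
have FpD (a b : 'F_p) : ((a + b)%R : nat)%:R = (a : nat)%:R + (b : nat)%:R :> k.
  rewrite -natrD /= [X in _ = X%:R](divn_eq (a + b) p) natrD natrM.
  rewrite kp mulr0 add0r.
  by congr (modn _ _)%:R; apply: Fp_cast.
exists (fun u => \sum_j c 0 j * (co u 0 j : nat)%:R) => [u v Lu Lv|j].
  rewrite -big_split /=; apply: eq_bigr => j _.
  by rewrite coM // mxE FpD mulrDr.
rewrite liftK (bigD1 j) //= big1 => [|i ij]; rewrite mxE !eqxx.
  have -> : nat_of_ord ((true && true)%:R : 'F_p) = 1%N by apply: modn_small.
  by rewrite mulr1 addr0.
by rewrite (negbTE ij) /= mulr0.
Qed.

End AdditiveCharacters.

(** * The group of linear characters and the representation ring *)

(** The kernel and the image of u |-> u ^ p have complementary orders. *)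
Lemma card_powers_quotient (gT : finGroupType) (L : {group gT}) (p : nat) :
  abelian L ->
  #|(L / group_powers L p)%g| = #|[set u in L | (u ^+ p)%g == 1%g]|.
Proof.
move=> cLL; have nKL := powers_normal p cLL.
have expM : {in L &, {morph (fun u => (u ^+ p)%g) : u v / (u * v)%g}}.
  by move=> u v Lu Lv; apply: expgMn; apply: (centsP cLL).
pose f := Morphism expM.
have kerE : ('ker f)%g = [set u in L | (u ^+ p)%g == 1%g].
  by apply/setP=> u; rewrite !inE.
have imE : (f @* L)%g = powers_group p cLL by apply: morphimEdom.
have cL : (#|('ker f)%g| * #|powers_group p cLL|)%N = #|L|.
  by rewrite -imE card_morphim setIid; apply/Lagrange/subsetIl.
move: cL; rewrite kerE -(Lagrange (normal_sub nKL)) mulnC.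
have -> : #|(L / group_powers L p)%g| = #|L : powers_group p cLL|%g.
  exact: card_quotient (normal_norm nKL).
by move/eqP; rewrite eqn_pmul2l ?cardG_gt0 // => /eqP ->.
Qed.

(** The finite group L together with cF stands for the group of linear
    characters of G. *)
Section LinearCharacters.
Variables (gT : finGroupType) (G : {group gT}) (L : finGroupType).
Variable cF : L -> 'CF(G).
Hypotheses (cGG : abelian G) (cF_inj : injective cF).
Hypothesis cF_lin : forall u, cF u \is a linear_char.
Hypothesis cF_onto : forall phi, phi \is a linear_char -> exists u, phi = cF u.
Hypotheses (cF1 : cF 1%g = 1).
Hypothesis cFM : {morph cF : u v / (u * v)%g >-> u * v}.
Hypothesis cFX : forall k, {morph cF : u / (u ^+ k)%g >-> u ^+ k}.

Lemma dual_group_abelian : abelian [set: L].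
Proof. by apply/centsP=> u _ v _; apply: cF_inj; rewrite !cFM mulrC. Qed.

Lemma linear_char_powers (p : nat) u :
  ((u ^+ p)%g == 1%g) = (group_powers G p \subset cfker (cF u)).
Proof.
have lin_u := cF_lin u; have char_u := lin_charW lin_u.
apply/eqP/subsetP => [up _ /imsetP[g Gg ->]|kerG].
  rewrite cfkerEchar // inE groupX //= lin_char1 // lin_charX //.
  by rewrite -exp_cfunE // -cFX up cF1 cfun1E Gg.
apply: cF_inj; rewrite cFX cF1; apply/cfun_inP => g Gg.
rewrite exp_cfunE // -lin_charX // cfun1E Gg.
have /kerG : (g ^+ p)%g \in group_powers G p by apply/imsetP; exists g.
by rewrite cfkerEchar // inE lin_char1 // => /andP[_ /eqP->].
Qed.

(** Both sides count the characters of G that are trivial on G^p: on the left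
    as the elements of L killed by p, on the right as the irreducible characters
    of the abelian group G / G^p. *)
Lemma card_dual_powers_quotient (p : nat) :
  #|([set: L] / group_powers [set: L] p)%g| = #|(G / group_powers G p)%g|.
Proof.
rewrite (card_powers_quotient (L := [set: L]%G) p dual_group_abelian).
have nKG := powers_normal p cGG.
transitivity #|Iirr (G / powers_group p cGG)%G|; last first.
  exact: card_Iirr_abelian (quotient_abelian _ cGG).
rewrite -cardsT -(card_imset _ (can_inj (mod_IirrK nKG))).
have cFE u : 'chi_(cfIirr (cF u)) = cF u by rewrite cfIirrE ?lin_char_irr.
rewrite -(card_imset _ (_ : injective (fun u => cfIirr (cF u)))); last first.
  by move=> u v /(congr1 (fun i => 'chi[G]_i)); rewrite !cFE => /cF_inj.
apply: eq_card => i; apply/imsetP/imsetP => [[u]|[j _ ->]].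
  rewrite !inE /= linear_char_powers => kerG ->.
  exists (quo_Iirr (powers_group p cGG) (cfIirr (cF u))) => //.
  by rewrite quo_IirrK // cFE.
have [u uE] := cF_onto (char_abelianP _ cGG (mod_Iirr j)).
exists u; last by apply: irr_inj; rewrite cFE.
by rewrite !inE linear_char_powers -uE mod_IirrE // cfker_mod.
Qed.

Fact linear_char_vchar u : cF u \in 'Z[irr G]%g.
Proof. exact/char_vchar/lin_charW. Qed.

Definition linear_repr (u : L) : repr_ring G :=
  exist _ (cF u) (linear_char_vchar u).

Lemma linear_repr1 : linear_repr 1%g = 1.
Proof. exact: val_inj. Qed.

Lemma linear_reprM u v : linear_repr (u * v)%g = linear_repr u * linear_repr v.
Proof. exact/val_inj/cFM. Qed.

(** The multiplicity of 'chi_i is an integer for a virtual character, so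
    taking the floor only serves to read it in int. *)
Definition repr_coord (i : Iirr G) (r : repr_ring G) : int :=
  Num.floor '[val r, 'chi_i].

Lemma repr_coordD i r s :
  repr_coord i (r + s) = repr_coord i r + repr_coord i s.
Proof.
have Zc (t : repr_ring G) := Cint_cfdot_vchar_irr i (valP t).
by rewrite /repr_coord raddfD cfdotDl real_floorDzr ?Zc // Rreal_int ?Zc.
Qed.

Lemma repr_coord_linear i u :
  repr_coord i (linear_repr u) = ('chi_i == cF u)%:R.
Proof.
rewrite /repr_coord /= -[cF u](cfIirrE (lin_char_irr (cF_lin u))) cfdot_irr.
rewrite (inj_eq irr_inj) eq_sym; case: eqP => _.
  exact: (intrKfloor (1 : int)).
exact: (intrKfloor (0 : int)).
Qed.

(** Virtual characters are integral combinations of irreducible characters,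
    and these are linear because G is abelian. *)
Lemma repr_ring_ind (Q : repr_ring G -> Prop) :
  (forall r s, Q r -> Q s -> Q (r + s)) -> (forall r, Q r -> Q (- r)) ->
  (forall u, Q (linear_repr u)) -> forall r, Q r.
Proof.
move=> QD QN QL r.
have Q0 : Q 0.
  by rewrite -(subrr (linear_repr 1%g)); apply: (QD); last apply: QN.
have /fin_all_exists[U UE] i := cF_onto (char_abelianP _ cGG i).
have -> : r = \sum_i linear_repr (U i) *~ repr_coord i r.
  apply: val_inj; rewrite raddf_sum [val r in LHS]cfun_sum_cfdot.
  apply: eq_bigr => i _; rewrite raddfMz /= -UE -scaler_int floorK //.
  exact: (Cint_cfdot_vchar_irr i (valP r)).
elim/big_ind: _ => // i _; have Qn m : Q (linear_repr (U i) *+ m).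
  by elim: m => // m IH; rewrite mulrS; apply: (QD).
by case: (repr_coord i r) => m; rewrite ?NegzE ?mulrNz; [|apply: QN]; apply: Qn.
Qed.

End LinearCharacters.

(** * Derivations of the representation ring *)

Section RingTensorFacts.
Variables A B : comNzRingType.

Lemma rpureDl (a a' : A) (b : B) : rpure (a + a') b = rpure a b + rpure a' b.
Proof. exact: pureDl. Qed.

Lemma rtensor_pure_ind (Q : rtensor A B -> Prop) :
  (forall x y, Q x -> Q y -> Q (x + y)) -> (forall x, Q x -> Q (- x)) ->
  (forall a b, Q (rpure a b)) -> forall x, Q x.
Proof.
move=> QD QN Qp; apply: tensor_ind => [|c a b x Qx].
  by rewrite -[0](subrr (rpure (0 : A) (0 : B))); apply: (QD); last apply: (QN).
apply: (QD) => //; rewrite -pureZl -[c]intz scaler_int; apply: Qp.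
Qed.

End RingTensorFacts.

Section ReprRingDerivations.
Variables (gT : finGroupType) (G : {group gT}) (xi : algC).
Local Notation B := (repr_ring_adjoin G xi).
Variables (k : comNzRingType) (psi : {rmorphism B -> k}).

Definition repr_incl (r : repr_ring G) : B := rpure r 1.

Lemma rpureE (r : repr_ring G) (a : int_adjoin xi) :
  rpure r a = repr_incl r * adjoin_map G xi a.
Proof. by rewrite [RHS]rtmul_pure mulr1 mul1r. Qed.

Lemma repr_inclM r s : repr_incl (r * s) = repr_incl r * repr_incl s.
Proof. by rewrite [RHS]rtmul_pure mulr1. Qed.

Lemma repr_inclD r s : repr_incl (r + s) = repr_incl r + repr_incl s.
Proof. exact: rpureDl. Qed.

Lemma repr_inclN r : repr_incl (- r) = - repr_incl r.
Proof.
apply: (addrI (repr_incl r)); rewrite -repr_inclD !subrr.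
by apply: (addrI (repr_incl 0)); rewrite -repr_inclD !addr0.
Qed.

(** The extension is r (x) a |-> D0 r * psi a; it vanishes on the scalars
    1 (x) a because the Leibniz rule for 1 * 1 forces D0 1 = 0. *)
Lemma derivation_extend (D0 : repr_ring G -> k) :
  (forall r s, D0 (r + s) = D0 r + D0 s) ->
  (forall r s, D0 (r * s) =
     psi (repr_incl r) * D0 s + psi (repr_incl s) * D0 r) ->
  exists2 D, is_derivation (adjoin_map G xi) psi D &
    forall r, D (repr_incl r) = D0 r.
Proof.
move=> D0D D0M.
pose F (r : zmodule (repr_ring G)) (a : zmodule (int_adjoin xi)) : zmodule k :=
  D0 r * psi (adjoin_map G xi a).
have Fl a : linear (F^~ a) by apply: int_linear => r s; rewrite /F D0D mulrDl.
have Fr r : linear (F r).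
  by apply: int_linear => a b; rewrite /F !rmorphD mulrDr.
pose D (x : B) : k := tlift F x.
have DD x y : D (x + y) = D x + D y.
  exact: (linear_funD (tlift_linear Fl Fr)).
have DN x : D (- x) = - D x.
  by apply: (addrI (D x)); rewrite -DD !subrr;
    apply: linear_fun0 (tlift_linear Fl Fr).
have Dp r a : D (rpure r a) = D0 r * psi (adjoin_map G xi a).
  exact: (tlift_pure Fl Fr).
have Dincl r : D (repr_incl r) = D0 r by rewrite Dp !rmorph1 mulr1.
have D01 : D0 1 = 0.
  have := D0M 1 1; rewrite mulr1 rmorph1 mul1r => D01.
  by apply: (addrI (D0 1)); rewrite addr0 -D01.
exists D => //; split=> // [x y|a]; last by rewrite Dp D01 mul0r.
elim/rtensor_pure_ind: x => [x x' IH IH'|x IH|r a].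
- by rewrite mulrDl !DD IH IH' rmorphD mulrDl mulrDr addrACA.
- by rewrite mulNr !DN IH rmorphN mulNr mulrN opprD.
elim/rtensor_pure_ind: y => [y y' IH IH'|y IH|s b].
- by rewrite mulrDr !DD IH IH' rmorphD mulrDl mulrDr addrACA.
- by rewrite mulrN !DN IH rmorphN mulNr mulrN opprD.
have -> : (rpure r a : B) * rpure s b = rpure (r * s) (a * b).
  exact: rtmul_pure.
rewrite !Dp D0M !rpureE !rmorphM mulrDl.
congr (_ + _); first by rewrite mulrACA.
by rewrite [psi _ * psi (adjoin_map _ _ b)]mulrC mulrACA.
Qed.

End ReprRingDerivations.

Section DerivationsAndCharacters.
Variables (gT : finGroupType) (G : {group gT}) (L : finGroupType).
Variable cF : L -> 'CF(G).
Hypotheses (cGG : abelian G) (cF_inj : injective cF).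
Hypothesis cF_lin : forall u, cF u \is a linear_char.
Hypothesis cF_onto : forall phi, phi \is a linear_char -> exists u, phi = cF u.
Hypotheses (cF1 : cF 1%g = 1).
Hypothesis cFM : {morph cF : u v / (u * v)%g >-> u * v}.
Variables (xi : algC) (k : fieldType).
Variable psi : {rmorphism repr_ring_adjoin G xi -> k}.

Notation chi u := (repr_incl xi (linear_repr cF_lin u)).
Notation derivation := (is_derivation (adjoin_map G xi) psi).

Lemma chiM u v : chi (u * v)%g = chi u * chi v.
Proof. by rewrite linear_reprM // repr_inclM. Qed.

Lemma psi_chi_neq0 u : psi (chi u) != 0.
Proof.
apply/eqP => u0; have : psi (chi (u^-1 * u)%g) = 1.
  by rewrite mulVg linear_repr1 // rmorph1.
by rewrite chiM rmorphM u0 mulr0 => /esym/eqP; rewrite oner_eq0.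
Qed.

Definition log_derivative (D : repr_ring_adjoin G xi -> k) (u : L) : k :=
  D (chi u) / psi (chi u).

(** This is the Leibniz rule for chi u * chi v, divided by psi of the
    product. *)
Lemma log_derivativeM D : derivation D ->
  additive_char [set: L]%G (log_derivative D).
Proof.
case=> _ DM _ u v _ _; rewrite /log_derivative chiM DM rmorphM.
by rewrite addf_div ?psi_chi_neq0 // addrC !(mulrC (psi _) (D _)).
Qed.

(** D is determined by its values on linear characters, since these span
    R(G) additively and D is linear over Z[xi]. *)
Lemma log_derivative_eq0 D :
  derivation D -> (forall u, log_derivative D u = 0) -> forall x, D x = 0.
Proof.
case=> DD DM DC D0.
have Dchi u : D (chi u) = 0.
  move: (D0 u) => /eqP; rewrite mulf_eq0 invr_eq0 (negbTE (psi_chi_neq0 u)).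
  by rewrite orbF => /eqP.
have Dz : D 0 = 0 by apply: (addrI (D 0)); rewrite -DD !addr0.
have DN x : D (- x) = - D x by apply: (addrI (D x)); rewrite -DD !subrr.
elim/rtensor_pure_ind => [x y IHx IHy|x IHx|r a].
- by rewrite DD IHx IHy addr0.
- by rewrite DN IHx oppr0.
rewrite rpureE DM DC mulr0 add0r.
have repr_ind := repr_ring_ind cGG (cF_lin := cF_lin) cF_onto.
suff -> : D (repr_incl xi r) = 0 by rewrite mulr0.
elim/repr_ind: r => [r s IHr IHs|r IHr|//].
  by rewrite repr_inclD DD IHr IHs addr0.
by rewrite repr_inclN DN IHr oppr0.
Qed.

(** The derivation is prescribed on the integral basis of R(G) made of linear
    characters; the Leibniz rule is biadditive, hence follows from its
    instances on pairs of basis elements, where it is the additivity of h. *)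
Lemma log_derivative_surj h : additive_char [set: L]%G h ->
  exists2 D, derivation D & log_derivative D =1 h.
Proof.
move=> hM.
have /fin_all_exists[U UE] i := cF_onto (char_abelianP _ cGG i).
pose D0 (r : repr_ring G) : k :=
  \sum_i (repr_coord i r)%:~R * (psi (chi (U i)) * h (U i)).
have D0D r s : D0 (r + s) = D0 r + D0 s.
  rewrite -big_split /=; apply: eq_bigr => i _.
  by rewrite repr_coordD intrD mulrDl.
have D0N r : D0 (- r) = - D0 r.
  have D00 : D0 0 = 0 by apply: (addrI (D0 0)); rewrite -D0D !addr0.
  by apply: (addrI (D0 r)); rewrite -D0D !subrr.
have D0chi u : D0 (linear_repr cF_lin u) = psi (chi u) * h u.
  pose i0 := cfIirr (cF u).
  have i0E : 'chi_i0 = cF u by rewrite cfIirrE ?lin_char_irr.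
  rewrite /D0 (bigD1 i0) //= repr_coord_linear i0E eqxx mul1r.
  have -> : U i0 = u by apply: cF_inj; rewrite -UE.
  rewrite big1 ?addr0 // => i ii0; rewrite repr_coord_linear -i0E.
  by rewrite (inj_eq irr_inj) (negbTE ii0) mul0r.
have repr_ind := repr_ring_ind cGG (cF_lin := cF_lin) cF_onto.
have D0M r s : D0 (r * s) =
    psi (repr_incl xi r) * D0 s + psi (repr_incl xi s) * D0 r.
  elim/repr_ind: r => [r r' IH IH'|r IH|u].
  - by rewrite mulrDl !D0D IH IH' repr_inclD rmorphD mulrDl mulrDr addrACA.
  - by rewrite mulNr !D0N IH repr_inclN rmorphN mulNr mulrN opprD.
  elim/repr_ind: s => [s s' IH IH'|s IH|v].
  - by rewrite mulrDr !D0D IH IH' repr_inclD rmorphD mulrDl mulrDr addrACA.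
  - by rewrite mulrN !D0N IH repr_inclN rmorphN mulNr mulrN opprD.
  rewrite -linear_reprM // !D0chi chiM rmorphM hM ?inE // mulrDr addrC -mulrA.
  by congr (_ + _); rewrite mulrCA mulrA.
have [D DP DE] := derivation_extend D0D D0M; exists D => // u.
by rewrite /log_derivative DE D0chi mulrC mulKf // psi_chi_neq0.
Qed.

End DerivationsAndCharacters.

(** * The dimension of the tangent space *)

(** Coordinates on V suffice to know its dimension: the inverse of a linear
    bijection is obtained by choosing preimages, and is linear by
    injectivity. *)
Lemma has_dim_coord (k : fieldType) (V : lmodType k) d (ev : V -> 'rV[k]_d) :
  linear ev -> (forall v, ev v = 0 -> v = 0) ->
  (forall c, exists v, ev v = c) ->
  has_dim V d.
Proof.
move=> evlin ev0 evS.
have evI u v : ev u = ev v -> u = v.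
  move=> e; apply/eqP; rewrite -subr_eq0; apply/eqP/ev0.
  by rewrite (linear_funB evlin) e subrr.
pose f c := sval (cid (evS c)).
have fK c : ev (f c) = c by rewrite /f; case: cid.
have flin : linear f by move=> a u v; apply: evI; rewrite evlin !fK.
exists (HB.pack_for {linear 'rV[k]_d -> V} f
  (GRing.isLinear.Build _ _ _ _ f flin)).
by exists ev => v; [exact: fK | apply: evI; rewrite fK].
Qed.

(** The residue field of P enters only through its characteristic and the
    map psi, so the dimension is computed for any field under B. *)
Lemma has_dim_tangent_to_field (gT : finGroupType) (G : {group gT}) (xi : algC)
    (p : nat) (k : fieldType) (psi : {rmorphism repr_ring_adjoin G xi -> k}) :
  abelian G -> prime p -> p%:R = 0 :> k ->
  exists d : nat,
    has_dim (dual (base_change psi (kahler (adjoin_map G xi)))) d /\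
    (p ^ d)%N = #|(G / group_powers G p)%g|.
Proof.
move=> cGG p_pr k_p.
have [L [cF [cFI _ cFl cFo] [cF1 cFM cFX _ _]]] := lin_char_group G.
have cLL := dual_group_abelian cFI cFM.
have [d [x [dE _ /(_ _ k_p)[h0 hS]]]] := additive_char_coordinates cLL p_pr.
exists d; split; last first.
  rewrite dE.
  exact: (card_dual_powers_quotient cGG cFI cFl cFo cF1 cFM cFX p).
pose logd (f : dual (base_change psi (kahler (adjoin_map G xi)))) :=
  log_derivative cFl psi (derivation_of f).
have logdM f : additive_char [set: L]%G (logd f).
  by apply: log_derivativeM => //; apply: derivation_ofP.
pose ev f := \row_j logd f (x j).
apply: (has_dim_coord (ev := ev)) => [a f g|f evf|c].
- by apply/rowP=> j; rewrite !mxE /logd /log_derivative mulrDl mulrA.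
- have logf0 u : logd f u = 0.
    apply: (h0 _ (logdM f)) => [j|]; last by rewrite inE.
    by move/rowP/(_ j): evf; rewrite !mxE.
  apply: derivation_of_inj => b.
  exact: (log_derivative_eq0 cGG cFo cF1 cFM (derivation_ofP f) logf0).
have [h hM hx] := hS c.
have [D DP Dh] := log_derivative_surj cGG cFI cFl cFo cF1 cFM psi hM.
have [f fD] := derivation_of_surj DP; exists f; apply/rowP=> j.
by rewrite mxE -hx -Dh /logd /log_derivative fD.
Qed.

(** Unfolding the tangent space over arbitrary rings keeps the comparison of
    the module structures on both sides away from the concrete ring B. *)
Lemma tangent_has_dim (A B : comNzRingType) (phi : {rmorphism A -> B})
    (P : prime_idealr B) (d : nat) :
  has_dim (dual (base_change (residue_map P) (kahler phi))) d ->
  has_dim (tangent phi P) d.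
Proof. exact. Qed.

Theorem corollary4p3 (gT : finGroupType) (G : {group gT}) (n : nat) (xi : algC)
    (p : nat) (P : prime_idealr (repr_ring_adjoin G xi)) :
  abelian G -> #|G| = n -> n.-primitive_root xi ->
  prime p -> p%:R \in P ->
  exists d : nat,
    has_dim (tangent (adjoin_map G xi) P) d /\
    (p ^ d)%N = #|(G / group_powers G p)%g|.
Proof.
move=> cGG _ _ p_pr Pp.
have k_p : p%:R = 0 :> residue_field P.
  rewrite -(rmorph_nat (residue_map P)) -[RHS](rmorph0 (residue_map P)).
  by congr (FracField.tofrac _); apply/eqP; rewrite -Quotient.idealrBE subr0.
have [d [dim_d card_d]] :=
  has_dim_tangent_to_field (residue_map P) cGG p_pr k_p.
by exists d; split=> [|//]; apply: tangent_has_dim; exact: dim_d.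
Qed.
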